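(* Let $(N,T,f)$ be a linear game ladder. Then $\succeq$ is a complete preorder on $N$ (complete, reflexive and transitive), and $\succ$ is a finite union of tournaments.
   Context: A game ladder is a triple $(N,T,f)$ where $N=\{1,\dots,n\}$ is a non-empty finite set of players, $T=\{1,\dots,m\}$ with $m\ge 2$ is an ordered set of positions (higher index = more important position), and $f:T^N\to\mathbb{R}$ is monotonic: for all $x,z\in T^N$ with $x\le z$ componentwise, $f(x)\le f(z)$. For $p\in N$, $e^p$ denotes the $p$-th unit vector. For players $p,q$ and positions $r>s$ in $T$, write $p\succeq_{(r,s)}q$ if for every $x\in T^N$ with $x_p=x_q=s$ one has $f(x+(r-s)e^p)\ge f(x+(r-s)e^q)$. Write $p\succeq q$ if $p\succeq_{(r,s)}q$ for all $r,s\in T$ with $r>s$; $p\succ q$ means $p\succeq q$ and not $q\succeq p$. The game ladder is linear if $\succeq$ is complete, i.e. for all $p,q\in N$, $p\succeq q$ or $q\succeq p$. A tournament is a binary relation that is complete and asymmetric (on the set of elements it relates); ''$\succ$ is a finite union of tournaments'' means $\succ$ equals the union of finitely many such relations. *)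

(* Defs.v *)
From mathcomp Require Import all_boot all_order all_algebra.
From mathcomp Require Import reals.

Set Implicit Arguments.
Unset Strict Implicit.
Unset Printing Implicit Defensive.

Import Order.TTheory GRing.Theory Num.Theory.
Local Open Scope ring_scope.

(* Players 1, ..., n and positions 1, ..., m are numbered from 0: player
   number i + 1 is i : 'I_n and position number j + 1 is j : 'I_m.  Only the
   order of the positions and the differences r - s matter, and these are
   unaffected by the shift. *)
Definition profile (n m : nat) := {ffun 'I_n -> 'I_m}.

Definition profile_le (n m : nat) (x z : profile n m) : Prop :=
  forall i : 'I_n, (x i <= z i)%N.

Record game_ladder (R : realType) := GameLadder {
  nplayers : nat;
  npositions : nat;
  nplayers_gt0 : (0 < nplayers)%N;
  npositions_ge2 : (2 <= npositions)%N;
  payoff : profile nplayers npositions -> R;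
  payoff_mono : forall x z, profile_le x z -> payoff x <= payoff z }.

Notation player G := 'I_(nplayers G).
Notation position G := 'I_(npositions G).

(* For x p = s < r this is x + (r - s) e^p, see move_toE; replacing the p-th
   coordinate by r avoids having to leave T^N to form the sum. *)
Definition move_to (n m : nat) (x : profile n m) (p : 'I_n) (r : 'I_m) :
    profile n m :=
  [ffun i => if i == p then r else x i].

Lemma move_toE (n m : nat) (x : profile n m) (p : 'I_n) (r s : 'I_m) :
  x p = s -> (s < r)%N ->
  forall i, (move_to x p r i : nat) = (x i + (r - s) * (i == p))%N.
Proof.
move=> xps lt_sr i; rewrite ffunE; case: eqP => [->|_].
  by rewrite muln1 xps subnKC // ltnW.
by rewrite muln0 addn0.
Qed.

(* p >=_(r,s) q *)
Definition desirable_at (R : realType) (G : game_ladder R)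
    (r s : position G) : rel (player G) := fun p q =>
  [forall x : profile (nplayers G) (npositions G),
     (x p == s) && (x q == s) ==>
       (payoff (move_to x p r) >= payoff (move_to x q r))].

(* p >= q *)
Definition desirable (R : realType) (G : game_ladder R) : rel (player G) :=
  fun p q => [forall r : position G, forall s : position G,
    (s < r)%N ==> desirable_at r s p q].

(* p > q *)
Definition strictly_desirable (R : realType) (G : game_ladder R) :
    rel (player G) :=
  fun p q => desirable p q && ~~ desirable q p.

Definition linear_ladder (R : realType) (G : game_ladder R) : Prop :=
  total (@desirable R G).

Definition complete_preorder (V : Type) (E : rel V) : Prop :=
  [/\ total E, reflexive E & transitive E].

Definition related (V : finType) (E : rel V) : {set V} :=
  [set x | [exists y, E x y || E y x]].

(* An asymmetric relation is irreflexive, so completeness can only be asked of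
   pairs of distinct elements.  The empty relation is a tournament. *)
Definition tournament (V : finType) (E : rel V) : Prop :=
  {in related E &, forall x y, x != y -> E x y || E y x} /\
  (forall x y, E x y -> ~~ E y x).

Definition finite_union_of_tournaments (V : finType) (E : rel V) : Prop :=
  exists (k : nat) (U : 'I_k -> rel V),
    (forall i, tournament (U i)) /\
    (forall x y, E x y = [exists i, U i x y]).

(* Main.v *)
Require Import Defs.
From mathcomp Require Import all_boot all_order all_algebra.
From mathcomp Require Import perm.
From mathcomp Require Import reals.

(* Desirability p >= q says that the payoff does not decrease when p and q
   exchange positions, provided the higher of the two positions goes to p.
   Let p >= q >= t with x_p <= x_t; the exchange of p and t has to be shown not
   to decrease the payoff.  If p >= t fails, linearity gives t >= p, so that
   all exchanges along the cycle p >= q >= t >= p are available; depending on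
   where x_q lies relative to x_p and x_t, the exchange of p and t is a
   composition of three favourable ones.
   Every pair (p, q) with p > q is by itself a tournament on {p, q}. *)

Import Order.TTheory.
Local Open Scope ring_scope.

Definition swap {n m : nat} (x : profile n m) (p q : 'I_n) : profile n m :=
  [ffun i => x (tperm p q i)].

Lemma swapL {n m : nat} (x : profile n m) p q : swap x p q p = x q.
Proof. by rewrite ffunE tpermL. Qed.

Lemma swapR {n m : nat} (x : profile n m) p q : swap x p q q = x p.
Proof. by rewrite ffunE tpermR. Qed.

Lemma swapD {n m : nat} (x : profile n m) p q i :
  p != i -> q != i -> swap x p q i = x i.
Proof. by move=> npi nqi; rewrite ffunE tpermD. Qed.

Lemma swap_id {n m : nat} (x : profile n m) p q : x p = x q -> swap x p q = x.
Proof.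
by move=> xpq; apply/ffunP => i; rewrite ffunE; case: tpermP => // ->.
Qed.

Lemma profile_eq3 {n m : nat} (x y : profile n m) p q t :
  x p = y p -> x q = y q -> x t = y t ->
  (forall i, p != i -> q != i -> t != i -> x i = y i) -> x = y.
Proof.
move=> xyp xyq xyt xyi; apply/ffunP => i.
have [<-//|npi] := eqVneq p i; have [<-//|nqi] := eqVneq q i.
have [<-//|nti] := eqVneq t i; exact: xyi.
Qed.

(** When [x p < x q], lowering [q] to [x p] gives a base profile with [p] and [q] level: raising [q]
    from it restores [x], raising [p] instead gives the swap. Conversely, two players who start
    level have raised profiles that are swaps of each other. *)
Lemma desirableP (R : realType) (G : game_ladder R) (p q : player G) :
  reflect (forall x : profile (nplayers G) (npositions G),
             (x p <= x q)%N -> payoff x <= payoff (swap x p q))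
          (desirable p q).
Proof.
apply: (iffP forallP) => [des x | des r].
  rewrite leq_eqVlt => /orP[/eqP/val_inj xpq | lt_pq].
    by rewrite swap_id.
  have npq : p != q by apply: contraTneq lt_pq => ->; rewrite ltnn.
  have /forallP/(_ (x p))/implyP/(_ lt_pq) := des (x q).
  move=> /forallP/(_ (move_to x q (x p)))/implyP.
  rewrite !ffunE (negPf npq) !eqxx => /(_ isT).
  have -> : move_to (move_to x q (x p)) q (x q) = x.
    by apply/ffunP => i; rewrite !ffunE; case: eqP => // ->.
  suff -> : move_to (move_to x q (x p)) p (x q) = swap x p q by [].
  apply/ffunP => i; rewrite !ffunE.
  case: tpermP => [->|->|/eqP nip /eqP niq].
  - by rewrite eqxx.
  - by rewrite eq_sym (negPf npq) eqxx.
  - by rewrite (negPf nip) (negPf niq).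
apply/forallP => s; apply/implyP => lt_sr; apply/forallP => x.
apply/implyP => /andP[/eqP xp /eqP xq].
have [->|npq] := eqVneq p q; first exact: lexx.
have -> : move_to x p r = swap (move_to x q r) p q.
  apply/ffunP => i; rewrite !ffunE.
  case: tpermP => [->|->|/eqP nip /eqP niq].
  - by rewrite !eqxx.
  - by rewrite eq_sym (negPf npq) xp xq.
  - by rewrite (negPf nip) (negPf niq).
by apply: des; rewrite !ffunE eqxx (negPf npq) xp ltnW.
Qed.

Lemma desirable_trans (R : realType) (G : game_ladder R) :
  linear_ladder G -> transitive (@desirable R G).
Proof.
move=> lin q p t pq qt.
have [->//|npq] := eqVneq p q.
have [<-//|nqt] := eqVneq q t.
have [<-|npt] := eqVneq p t; first by have := lin p p; rewrite orbb.
have /orP[//|tp] := lin p t.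
have [nqp ntq ntp] : [/\ q != p, t != q & t != p] by split; rewrite eq_sym.
move: pq qt tp => /desirableP pq /desirableP qt /desirableP tp.
apply/desirableP => x le_pt.
have swapE := (@swapL, @swapR, @swapD).
have [le_pq|/ltnW le_qp] := leqP (x p) (x q); last first.
  (* With a, b, c the positions of [p], [q], [t] and b <= a <= c: (a,b,c) -> (a,c,b) -> (b,c,a) ->
     (c,b,a). *)
  have -> : swap x p t = swap (swap (swap x q t) t p) p q.
    by apply: (@profile_eq3 _ _ _ _ p q t) => *; rewrite !swapE.
  apply: le_trans (qt x _) _; first exact: leq_trans le_pt.
  apply: le_trans (tp _ _) _; first by rewrite !swapE //; apply: leq_trans le_pt.
  by apply: pq; rewrite !swapE //; apply: leq_trans le_pt.
have [le_qt|/ltnW le_tq] := leqP (x q) (x t).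
  (* Here a <= b <= c: (a,b,c) -> (b,a,c) -> (b,c,a) -> (c,b,a). *)
  have -> : swap x p t = swap (swap (swap x p q) q t) p q.
    by apply: (@profile_eq3 _ _ _ _ p q t) => *; rewrite !swapE.
  apply: le_trans (pq x le_pq) _.
  apply: le_trans (qt _ _) _; first by rewrite !swapE.
  by apply: pq; rewrite !swapE.
(* Here a <= c <= b: (a,b,c) -> (b,a,c) -> (c,a,b) -> (c,b,a). *)
have -> : swap x p t = swap (swap (swap x p q) t p) q t.
  by apply: (@profile_eq3 _ _ _ _ p q t) => *; rewrite !swapE.
apply: le_trans (pq x le_pq) _.
apply: le_trans (tp _ _) _; first by rewrite !swapE.
by apply: qt; rewrite !swapE.
Qed.

Lemma asymmetric_union_of_tournaments (V : finType) (E : rel V) :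
  (forall x y, E x y -> ~~ E y x) -> finite_union_of_tournaments E.
Proof.
move=> asymE.
(* All ordered pairs serve as indices; a pair outside [E] contributes the empty tournament. *)
pose U (i : 'I_#|{: V * V}|) : rel V :=
  fun x y => E x y && (enum_val i == (x, y)).
exists #|{: V * V}|, U; split=> [i | x y]; last first.
  apply/idP/existsP => [Exy | [i /andP[]//]].
  by exists (enum_rank (x, y)); rewrite /U Exy enum_rankK eqxx.
rewrite /U; case: (enum_val i) => a b; split=> [x y|x y /andP[Exy _]].
  (* A related element is [a] or [b], so two distinct ones are joined by the pair [(a, b)]
     itself. *)
  rewrite !inE => /existsP[x'] /orP[] /andP[Ex] /eqP[? ?]; subst;
  move=> /existsP[y'] /orP[] /andP[Ey] /eqP[? ?]; subst;
  by rewrite ?eqxx ?Ex ?orbT.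
by rewrite negb_and asymE.
Qed.

Theorem theorem1 (R : realType) (G : game_ladder R) :
  linear_ladder G ->
  complete_preorder (@desirable R G) /\
  finite_union_of_tournaments (@strictly_desirable R G).
Proof.
move=> lin; split.
  split=> // [p|]; first by have := lin p p; rewrite orbb.
  exact: desirable_trans.
apply: asymmetric_union_of_tournaments => p q /andP[_ nqp].
by rewrite negb_and nqp.
Qed.
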